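(* (Linear strong Artin approximation.) Let $B,\bar B$ be real or complex vector spaces and let $L(\varepsilon)=\sum_{i=0}^\infty\varepsilon^iL_i$, $L_i\in L(B,\bar B)$, be a formal power series of linear maps which stabilizes at some $k\ge0$. Then for every $l\ge1$ and every formal power series $b(\varepsilon)=\sum_{i=0}^\infty\varepsilon^ib_i$, $b_i\in B$, which is an approximation of order $k+l$, i.e. $$L(\varepsilon)\cdot b(\varepsilon)=\varepsilon^{k+l}\cdot\sum_{i=0}^\infty\varepsilon^i\,\bar b_{k+l+i}\quad\text{for some }\bar b_{k+l+i}\in\bar B,$$ there exists a formal power series $\hat b(\varepsilon)=\sum_{i=0}^\infty\varepsilon^i\hat b_i$, $\hat b_i\in B$, satisfying $$L(\varepsilon)\cdot\hat b(\varepsilon)=0\qquad\text{and}\qquad b_i=\hat b_i,\quad i=0,\dots,l-1.$$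
   Context: $L(B,\bar B)$ denotes linear maps (not necessarily bounded); products of formal power series are Cauchy products. For $k\ge0$ let $\bar R_k\subset\bar B$ be the subspace of leading coefficients of order $k$: $$\bar R_k:=\Big\{\sum_{i+j=k}L_ib_j\ \Big|\ b_0,\dots,b_k\in B,\ \sum_{i+j=m}L_ib_j=0\text{ for }m=0,\dots,k-1\Big\},$$ and $\bar R_{-1}:=\{0\}$. These subspaces are increasing in $k$. $L(\varepsilon)$ stabilizes at $k\ge0$ if $\bar R_{k-1}\subsetneq\bar R_k=\bar R_{k+l}$ for all $l\ge1$. *)

(* Defs.v *)
From HB Require Import structures.
From mathcomp Require Import all_boot all_order all_algebra.
From mathcomp Require Import boolp classical_sets reals.
From mathcomp Require Import complex.

Set Implicit Arguments.
Unset Strict Implicit.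
Unset Printing Implicit Defensive.

Import GRing.Theory.
Local Open Scope ring_scope.
Local Open Scope classical_set_scope.

(* A formal power series with coefficients in T is its coefficient sequence
   nat -> T. *)

(* Cauchy product L(e) . b(e): its n-th coefficient is the sum of L_i b_j over
   i + j = n, written with j = n - i for 0 <= i <= n. *)
Definition fps_app (K : fieldType) (B B' : lmodType K)
    (L : nat -> {linear B -> B'}) (b : nat -> B) : nat -> B' :=
  fun n => \sum_(i < n.+1) L i (b (n - i)%N).

(* e^n . c(e) *)
Definition fps_mulXn (V : zmodType) (n : nat) (c : nat -> V) : nat -> V :=
  fun m => if (m < n)%N then 0 else c (m - n)%N.

(* The subspace R_k. Coefficients of order at most k of L(e) . b(e) involve
   only b_0, ..., b_k, so b may range over full sequences. *)
Definition leading_coefs (K : fieldType) (B B' : lmodType K)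
    (L : nat -> {linear B -> B'}) (k : nat) : set B' :=
  [set y | exists b : nat -> B,
     (forall m, (m < k)%N -> fps_app L b m = 0) /\ y = fps_app L b k].

(* The subspace R_(k-1), with R_(-1) = {0}. *)
Definition leading_coefs_pred (K : fieldType) (B B' : lmodType K)
    (L : nat -> {linear B -> B'}) (k : nat) : set B' :=
  if k is k'.+1 then leading_coefs L k' else [set 0].

Definition stabilizes_at (K : fieldType) (B B' : lmodType K)
    (L : nat -> {linear B -> B'}) (k : nat) : Prop :=
  leading_coefs_pred L k `<` leading_coefs L k /\
  (forall l, (1 <= l)%N -> leading_coefs L k = leading_coefs L (k + l)%N).

(* Main.v *)
Require Import Defs.
From HB Require Import structures.
From mathcomp Require Import all_boot all_order all_algebra.
From mathcomp Require Import boolp classical_sets reals.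
From mathcomp Require Import complex.

Set Implicit Arguments.
Unset Strict Implicit.
Unset Printing Implicit Defensive.

Import GRing.Theory.
Local Open Scope ring_scope.

(** The obstruction to raising the order of an approximation is one
    coefficient, and after stabilization it can be removed late.  If
    [L(e) . b(e)] vanishes below order [k + d] with [d >= 1], its coefficient
    of order [k + d] lies in R_(k+d) = R_k, so it is also the leading
    coefficient of some [L(e) . c(e)] of order [k].  Then [b(e) - e^d c(e)] is
    an approximation of order [k + d + 1] that agrees with [b] below index [d]
    ([improve_approx]).  Applied with d = l, l + 1, ..., this correction
    changes each coefficient only finitely often and never changes those below
    [l], so the successive series converge in the e-adic topology, and
    continuity of the Cauchy product makes the limit an exact solution
    ([adic_limit]). *)

Section CauchyProduct.
Variables (K : fieldType) (B B' : lmodType K) (L : nat -> {linear B -> B'}).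

Lemma fps_appB (b c : nat -> B) n :
  fps_app L (fun i => b i - c i) n = fps_app L b n - fps_app L c n.
Proof. by rewrite /fps_app -sumrB; apply: eq_bigr => i _; rewrite linearB. Qed.

Lemma fps_app_mulXn d (c : nat -> B) :
  fps_app L (fps_mulXn d c) =1 fps_mulXn d (fps_app L c).
Proof.
move=> n; rewrite /fps_app /fps_mulXn; case: ltnP => [lt_nd | le_dn].
  apply: big1 => i _.
  by rewrite (leq_ltn_trans (leq_subr i n) lt_nd) linear0.
rewrite -(big_mkord xpredT (fun i => L i (if (n - i < d)%N then 0
                                          else c (n - i - d)%N))).
have le_m_n : ((n - d).+1 <= n.+1)%N by rewrite ltnS leq_subr.
rewrite (big_cat_nat (leq0n _) le_m_n) /=.
(* the terms with n - d < i meet a zero coefficient of e^d c(e) *)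
rewrite [X in _ + X]big_nat_cond [X in _ + X]big1 ?addr0 => [|i].
  rewrite big_mkord; apply: eq_bigr => i _; rewrite subnAC ifF //.
  apply/negbTE; rewrite -leqNgt.
  by rewrite leq_subRL ?(leq_trans (leq_ord i)) ?leq_subr // addnC
    -leq_subRL // leq_ord.
case/andP=> /andP[lt_i le_i] _.
by rewrite ifT ?linear0 // ltn_subLR // addnC -ltn_subLR.
Qed.

Lemma eq_fps_app n (b c : nat -> B) :
  (forall i, (i <= n)%N -> b i = c i) -> fps_app L b n = fps_app L c n.
Proof. by move=> eq_bc; apply: eq_bigr => i _; rewrite eq_bc ?leq_subr. Qed.

(** Since [L(e) . c(e)] starts at order [k], subtracting [e^d c(e)] cancels the
    coefficient of order [k + d] without disturbing the zeros below it. *)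
Lemma improve_approx k d (b : nat -> B) :
    leading_coefs L k = leading_coefs L (k + d)%N ->
    (forall m, (m < k + d)%N -> fps_app L b m = 0) ->
  exists b' : nat -> B,
    (forall m, (m < k + d.+1)%N -> fps_app L b' m = 0) /\
    (forall i, (i < d)%N -> b' i = b i).
Proof.
move=> eq_lead b0.
have : leading_coefs L (k + d)%N (fps_app L b (k + d)%N) by exists b.
rewrite -eq_lead => -[c [c0 eq_bc]].
exists (fun i => b i - fps_mulXn d c i); split=> [m|i lt_id]; last first.
  by rewrite /fps_mulXn lt_id subr0.
rewrite fps_appB fps_app_mulXn /fps_mulXn addnS ltnS leq_eqVlt.
case/predU1P=> [->|lt_m].
  by rewrite ltnNge leq_addl /= addnK eq_bc subrr.
rewrite b0 //; case: ltnP => [_|le_dm]; first by rewrite subrr.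
by rewrite c0 ?subrr // ltn_subLR // addnC.
Qed.

(** The diagonal [s_i(i)] is the e-adic limit of [s], since the coefficient of
    index [i] no longer changes from step [i] on; up to order [n] the limit
    cannot be told apart from [s_n]. *)
Lemma adic_limit (s : nat -> nat -> B) :
    (forall p i, (i <= p)%N -> s p.+1 i = s p i) ->
    (forall p, fps_app L (s p) p = 0) ->
  forall n, fps_app L (fun i => s i i) n = 0.
Proof.
move=> s_stable s0 n; rewrite -(s0 n); apply: eq_fps_app => i.
elim: n => [|n IHn]; first by rewrite leqn0 => /eqP->.
by rewrite leq_eqVlt => /predU1P[-> //|lt_in]; rewrite s_stable ?IHn.
Qed.

End CauchyProduct.

Theorem mainTheorem4 (R : realType) (K : fieldType)
    (real_or_complex : K = (R : fieldType) \/ K = (complex R : fieldType))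
    (B B' : lmodType K) (L : nat -> {linear B -> B'})
    (k : nat) (L_stab : stabilizes_at L k)
    (l : nat) (l_ge1 : (1 <= l)%N)
    (b : nat -> B)
    (b_approx : exists c : nat -> B', fps_app L b =1 fps_mulXn (k + l) c) :
  exists b' : nat -> B,
    (forall n, fps_app L b' n = 0) /\ (forall i, (i < l)%N -> b i = b' i).
Proof.
case: L_stab => _ eq_lead; case: b_approx => c b_c.
pose approx n (x : nat -> B) := forall m, (m < n)%N -> fps_app L x m = 0.
(* The step is made total, so that plain choice gives a function to iterate. *)
have step (px : nat * (nat -> B)) : exists y : nat -> B,
    approx (k + (l + px.1))%N px.2 ->
    approx (k + (l + px.1).+1)%N y /\
    (forall i, (i < l + px.1)%N -> y i = px.2 i).
  case: px => p x /=.
  have [x0|] := pselect (approx (k + (l + p))%N x); last by exists x.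
  have eq_p := eq_lead _ (leq_trans l_ge1 (leq_addr p l)).
  by have [y ?] := improve_approx eq_p x0; exists y.
have [f fP] := choice step.
pose s := fix s p := if p is q.+1 then f (q, s q) else b.
have s_approx p : approx (k + (l + p))%N (s p).
  elim: p => [|p IHp] /=; last by rewrite addnS; case: (fP (p, s p) IHp).
  by move=> m; rewrite addn0 b_c /fps_mulXn => ->.
have s_stable p i : (i < l + p)%N -> s p.+1 i = s p i.
  by move=> lt_i; case: (fP (p, s p) (s_approx p)) => _ /(_ i lt_i).
exists (fun i => s i i); split=> [|i lt_il].
  apply: adic_limit => [p i le_ip|p].
    by apply: s_stable; rewrite -add1n leq_add.
  by apply: s_approx; rewrite addnA -add1n leq_add2r ltn_addl.
(* below index l no step changes anything, whatever its number *)
elim: {2}i => [//|p ->].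
by rewrite s_stable // ltn_addr.
Qed.
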